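(* Let $K\in\{1,\dots,T-1\}$, let $f\in\mathcal{S}_K$ be a signal with $f_0=1$, and let $Z=ff^\dagger$ be the corresponding lifted matrix. Let $\varepsilon\in\mathbb{R}^m$ be the measurement noise vector, so that the observations are $b=\mathcal{A}(Z)+\varepsilon$. Suppose the least-squares estimator, applied to $b$, outputs $\widehat f$ as the final signal estimate. Then, up to some global phase $\phi\in[0,2\pi)$, $$\big\|\widehat f-\mathrm{e}^{\mathrm{i}\phi}f\big\|_2\le\frac{2(2\sqrt2+1)}{\sigma_{\min}(\mathcal{A},\mathcal{D}(L,Z))}\cdot\frac{\|\varepsilon\|_2}{\|f\|_2}.$$
   Context: Indices run over $0,\dots,T-1$. $\mathcal{S}_K$ is the set of $f\in\mathbb{C}^T$ that contain no run of $K$ consecutive zero entries. With $|i\rangle$ the standard basis vectors of $\mathbb{C}^T$, the family $\{A_\ell\}_{\ell=1}^m$, $m=T+K(2T-K-1)$, enumerates the Hermitian matrices $A^{(i,i)}=|i\rangle\langle i|$ for $0\le i\le T-1$, together with $A^{(i,j,\mathrm{Re})}=\tfrac12(|i\rangle\langle j|+|j\rangle\langle i|)$ and $A^{(i,j,\mathrm{Im})}=\tfrac1{2\mathrm{i}}(|i\rangle\langle j|-|j\rangle\langle i|)$ for $0\le i<j\le T-1$, $1\le j-i\le K$. The linear measurement map $\mathcal{A}$ is given by $[\mathcal{A}(X)]_\ell=\operatorname{Tr}[A_\ell X]$, $\ell=1,\dots,m$; it is real-valued on Hermitian $X\in\mathbb{C}^{T\times T}$. For vectors $\|\cdot\|_2$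 is the Euclidean norm; for matrices $\|\cdot\|_2$ is the Schatten-2 (Frobenius) norm. The loss is $L(X)=\|\mathcal{A}(X)-b\|_2^2$. Least-squares estimator: (1) compute $X^*\in\operatorname{argmin}_{X\succeq0}L(X)=\operatorname{argmin}_{X\succeq 0}\sum_{\ell=1}^m(\operatorname{Tr}[A_\ell X]-b_\ell)^2$ over positive semidefinite $X\in\mathbb{C}^{T\times T}$; (2) compute the largest eigenvalue $\lambda_{\max}$ of $X^*$ and a corresponding unit-norm (principal) eigenvector $v_{\max}$; (3) rotate and rescale the vector $\sqrt{\lambda_{\max}}\,v_{\max}$ so that its first entry (index $0$) equals $1$; (4) output the resulting vector as $\widehat f$. Descent cone at $Z$: $\mathcal{D}(L,Z)=\{\Delta\in\mathbb{C}^{T\times T}:\ \exists\,\tau>0\ \text{such that}\ Z+\tau\Delta\succeq0\ \text{and}\ L(Z+\tau\Delta)\le L(Z)\}$. Smallest conic singular value: $\sigma_{\min}(\mathcal{A},\mathcal{D}(L,Z))=\inf_{\Delta\in\mathcal{D}(L,Z)\setminus\{0\}}\|\mathcal{A}(\Delta)\|_2/\|\Delta\|_2$.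
   Formalization: The estimate is taken as the principal component √λ_max·v_max up to an arbitrary rotation; the rescaling that makes its first entry equal to 1 is omitted, since with it the claimed bound is false. *)

(* Defs.v *)
From mathcomp Require Import all_boot all_order all_algebra.
From mathcomp Require Import complex.
From mathcomp Require Import all_classical all_reals all_analysis.
From mathcomp Require Import zify.

Set Implicit Arguments.
Unset Strict Implicit.
Unset Printing Implicit Defensive.

Import Order.TTheory GRing.Theory Num.Theory.

Local Open Scope classical_set_scope.
Local Open Scope sesquilinear_scope.
Local Open Scope complex_scope.
Local Open Scope ring_scope.

Section Defs.
Variable R : realType.
Local Notation C := R[i].

(* Euclidean norm on column vectors, Frobenius (Schatten-2) norm on matrices.
   The library norm on 'M_(m, n) is the maximum norm. *)
Definition norm2 (m n : nat) (M : 'M[C]_(m, n)) : R :=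
  Num.sqrt (\sum_i \sum_j Normc.normc (M i j) ^+ 2).

Definition psdmx (n : nat) (X : 'M[C]_n) : Prop :=
  X \is hermsymmx /\ forall x : 'cV[C]_n, 0 <= (x ^t* *m X *m x) 0 0.

(* In the order of R[i], mu <= a%:C forces mu to be real. *)
Definition largest_eigenvalue (n : nat) (X : 'M[C]_n) (a : R) : Prop :=
  eigenvalue X a%:C /\ forall mu : C, eigenvalue X mu -> mu <= a%:C.

Definition no_zero_run (T K : nat) (f : 'cV[C]_T) : Prop :=
  ~ exists s : nat, (s + K <= T)%N /\
      forall i : 'I_T, (s <= i < s + K)%N -> f i 0 = 0.

Definition lift_mx (T : nat) (f : 'cV[C]_T) : 'M[C]_T := f *m f ^t*.

Definition band_pairs (T K : nat) : seq ('I_T * 'I_T) :=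
  [seq p : 'I_T * 'I_T <- enum {: 'I_T * 'I_T} | (p.1 < p.2)%N && (p.2 - p.1 <= K)%N].

Definition meas_re (T : nat) (i j : 'I_T) : 'M[C]_T :=
  2^-1 *: (delta_mx i j + delta_mx j i).

Definition meas_im (T : nat) (i j : 'I_T) : 'M[C]_T :=
  (2 * (0 +i* 1))^-1 *: (delta_mx i j - delta_mx j i).

Definition meas_mxs (T K : nat) : seq 'M[C]_T :=
  [seq delta_mx i i | i <- enum 'I_T] ++
  [seq meas_re p.1 p.2 | p <- band_pairs T K] ++
  [seq meas_im p.1 p.2 | p <- band_pairs T K].

Definition meas_dim (T K : nat) : nat := (T + K * (2 * T - K - 1))%N.

(* By size_meas_mxs below, the default value of nth is never reached. *)
Definition meas_map (T K : nat) (X : 'M[C]_T) : 'cV[C]_(meas_dim T K) :=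
  \col_l \tr (nth 0 (meas_mxs T K) l *m X).

Definition loss (T K : nat) (b : 'cV[C]_(meas_dim T K)) (X : 'M[C]_T) : R :=
  norm2 (meas_map K X - b) ^+ 2.

Definition ls_minimizer (T K : nat) (b : 'cV[C]_(meas_dim T K))
    (X : 'M[C]_T) : Prop :=
  psdmx X /\ forall Y : 'M[C]_T, psdmx Y -> loss b X <= loss b Y.

(* The principal component sqrt(lam) v is only determined up to a phase, and
   the final normalization is accordingly modelled by a factor c of modulus 1.
   Positive rescaling is excluded: dividing by the modulus of the first entry
   can make the output arbitrarily large at bounded noise, so that no bound of
   the form norm2 eps / norm2 f could hold. *)
Definition ls_estimate (T K : nat) (b : 'cV[C]_(meas_dim T K))
    (fhat : 'cV[C]_T) : Prop :=
  exists (X : 'M[C]_T) (lam : R) (v : 'cV[C]_T) (c : C),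
    [/\ ls_minimizer b X,
        largest_eigenvalue X lam,
        X *m v = lam%:C *: v /\ norm2 v = 1,
        `|c| = 1
      & fhat = c *: ((Num.sqrt lam)%:C *: v)].

Definition descent_cone (T : nat) (L : 'M[C]_T -> R) (Z : 'M[C]_T) :
    set 'M[C]_T :=
  [set D | exists2 tau : R, 0 < tau &
     psdmx (Z + tau%:C *: D) /\ L (Z + tau%:C *: D) <= L Z].

(* The infimum is taken in \bar R: it is +oo if the cone is reduced to 0. *)
Definition conic_sv (T m : nat) (A : 'M[C]_T -> 'cV[C]_m) (S : set 'M[C]_T) :
    \bar R :=
  ereal_inf [set (norm2 (A D) / norm2 D)%:E | D in S `\ 0].

Definition expi (phi : R) : C := cos phi +i* sin phi.

Lemma size_band_pairs (T K : nat) : (0 < K < T)%N ->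
  (2 * size (band_pairs T K) = K * (2 * T - K - 1))%N.
Proof.
move=> hK.
have -> : size (band_pairs T K) = (\sum_(i < T) minn K (T - 1 - i))%N.
  rewrite size_filter -sum1_count big_enum_cond /=.
  rewrite (eq_bigl (fun p : 'I_T * 'I_T =>
    true && ((p.1 < p.2)%N && (p.2 - p.1 <= K)%N))) //.
  rewrite -(pair_big_dep xpredT
    (fun i j : 'I_T => (i < j)%N && (j - i <= K)%N) (fun _ _ => 1%N)) /=.
  apply: eq_bigr => i _.
  rewrite (big_ord_widen_cond _ (fun j => (i < j)%N && (j - i <= K)%N)
    (fun _ => 1%N) (leqnn T)).
  rewrite (eq_bigl (fun j : 'I_T => (i < j < i + minn K (T - 1 - i) + 1)%N));
    last by move=> j /=; have := ltn_ord j; have := ltn_ord i; lia.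
  transitivity (\sum_(i.+1 <= j < i + minn K (T - 1 - i) + 1) 1)%N;
    last by rewrite sum_nat_const_nat; have := ltn_ord i; lia.
  rewrite big_nat [RHS](big_nat_widenl _ 0) //.
  rewrite (big_nat_widen _ _ T); last by have := ltn_ord i; lia.
  by rewrite big_mkord; apply: eq_bigl => j /=; lia.
rewrite -(big_mkord xpredT (fun i => minn K (T - 1 - i)))%N big_nat_rev /=.
have -> : (\sum_(0 <= i < T) minn K (T - 1 - (0 + T - i.+1)) =
           \sum_(0 <= i < T) minn K i)%N.
  by apply: eq_big_nat => i hi; congr minn; lia.
case/andP: hK => K0; elim: T => [//|T IH]; rewrite ltnS leq_eqVlt.
case/predU1P => [<-|KT]; last first.
  by rewrite big_nat_recr //= mulnDr IH //; nia.
rewrite (eq_big_nat _ _ (F2 := id)); last by move=> i hi; lia.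
rewrite bin2_sum mul2n bin2 halfK oddM /= andNb subn0; lia.
Qed.

Lemma size_meas_mxs (T K : nat) : (0 < K < T)%N ->
  size (meas_mxs T K) = meas_dim T K.
Proof.
move=> hK; rewrite !size_cat !size_map -enumT -cardE card_ord addnn -mul2n.
by rewrite size_band_pairs.
Qed.

End Defs.

(* Main.v *)
(* Let X be the least-squares minimizer, D = X - Z and u the rescaled principal
   eigenvector of X. Optimality gives L(X) <= L(Z), so D lies in the descent
   cone and ||A(D)|| <= 2 ||eps||, hence sigma_min ||D|| <= 2 ||eps||. Among
   the matrices g g^*, u u^* is the closest one to X, so
   ||u u^* - f f^*|| <= 2 ||D||. Once the phase is chosen so that f^* u >= 0,
   ||u - f||^2 ||f||^2 <= 2 ||u u^* - f f^*||^2, and altogether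
   ||u - f|| ||f|| <= 2 sqrt 2 ||D||.
   In the extended reals +oo * 0 = 0, so for sigma_min = 0 and eps = 0 the bound
   asserts exact recovery: a positive semidefinite matrix that agrees with f f^*
   on the band |i - j| <= K equals f f^* when f has no run of K zeros. *)
Require Import Defs.
From mathcomp Require Import all_boot all_order all_algebra.
From mathcomp Require Import complex.
From mathcomp Require Import all_classical all_reals all_analysis.
From mathcomp Require Import ring lra zify.

Import Order.TTheory GRing.Theory Num.Theory.

Local Open Scope classical_set_scope.
Local Open Scope sesquilinear_scope.
Local Open Scope complex_scope.
Local Open Scope ring_scope.

Set Implicit Arguments.
Unset Strict Implicit.

(** * Trace inequalities for Hermitian and rank-one matrices *)

Section Hermitian.
Variable C : numClosedFieldType.
Implicit Types (m n : nat).

Lemma mxtrace_mulmxtE m n (M : 'M[C]_(m, n)) :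
  \tr (M *m M ^t*) = \sum_i \sum_j `|M i j| ^+ 2.
Proof.
apply: eq_bigr => i _; rewrite mxE; apply: eq_bigr => j _.
by rewrite !mxE normCK.
Qed.

Lemma mxtrace_mulmxt_ge0 m n (M : 'M[C]_(m, n)) : 0 <= \tr (M *m M ^t*).
Proof.
rewrite mxtrace_mulmxtE; apply: sumr_ge0 => i _; apply: sumr_ge0 => j _.
exact: exprn_ge0.
Qed.

Lemma mxtrace_mulmxt_eq0 m n (M : 'M[C]_(m, n)) :
  \tr (M *m M ^t*) = 0 -> M = 0.
Proof.
rewrite mxtrace_mulmxtE => /psumr_eq0P h; apply/matrixP => i j; rewrite mxE.
have /psumr_eq0P/(_ j isT) : \sum_j `|M i j| ^+ 2 = 0.
  by apply: h => // k _; apply: sumr_ge0 => l _; exact: exprn_ge0.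
move=> h'; apply/eqP; rewrite -normr_eq0 -sqrf_eq0; apply/eqP/h' => l _.
exact: exprn_ge0.
Qed.

Lemma mxtraceN n (A : 'M[C]_n) : \tr (- A) = - \tr A.
Proof. exact: raddfN. Qed.

Lemma trmxC_mul m n p (A : 'M[C]_(m, n)) (B : 'M[C]_(n, p)) :
  (A *m B) ^t* = B ^t* *m A ^t*.
Proof. by rewrite trmx_mul map_mxM. Qed.

Lemma trmxCD m n (A B : 'M[C]_(m, n)) : (A + B) ^t* = A ^t* + B ^t*.
Proof. by rewrite linearD /= map_mxD. Qed.

Lemma trmxCB m n (A B : 'M[C]_(m, n)) : (A - B) ^t* = A ^t* - B ^t*.
Proof. by rewrite linearB /= map_mxB. Qed.

Lemma trmxCZ m n (a : C) (A : 'M[C]_(m, n)) : (a *: A) ^t* = a^* *: A ^t*.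
Proof. by rewrite linearZ /= map_mxZ. Qed.

Lemma hermsymmxE n (X : 'M[C]_n) : X \is hermsymmx -> X ^t* = X.
Proof. by move/is_hermitianmxP; rewrite expr0 scale1r => <-. Qed.

(** By the parallelogram law the gap between the two sides is the squared norm of A + B. *)
Lemma parallelogram_le m n (A B : 'M[C]_(m, n)) :
  \tr ((A - B) *m (A - B) ^t*) <=
  2 * (\tr (A *m A ^t*) + \tr (B *m B ^t*)).
Proof.
rewrite -subr_ge0; set x := (X in 0 <= X).
suff -> : x = \tr ((A + B) *m (A + B) ^t*) by exact: mxtrace_mulmxt_ge0.
rewrite /x trmxCB trmxCD !mulmxDl !mulmxDr !mulNmx !mulmxN.
rewrite !(mxtraceD, mxtraceN); ring.
Qed.

(** A unitary diagonalisation P turns the form into the sum of d_i |(P x)_i|^2, and each d_i is an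
    eigenvalue, with row i of P as eigenvector. *)
Lemma rayleigh_le n (X : 'M[C]_n) (a : C) (x : 'cV[C]_n) :
  X \is hermsymmx -> (forall mu, eigenvalue X mu -> mu <= a) ->
  (x ^t* *m X *m x) 0 0 <= a * (x ^t* *m x) 0 0.
Proof.
move=> Xh aP.
have [Pu eX] : spectralmx X \is unitarymx /\
    X = (spectralmx X) ^t* *m diag_mx (spectral_diag X) *m spectralmx X.
  have /hermitian_normalmx/orthomx_spectralP eX := Xh.
  split; first exact: spectral_unitarymx.
  by rewrite -invmx_unitary ?spectral_unitarymx // -eX.
set P := spectralmx X in Pu eX; set d := spectral_diag X in eX.
have PX : P *m X = diag_mx d *m P.
  by rewrite eX !mulmxA (unitarymxP Pu) mul1mx.
have PP : P ^t* *m P = 1%:M by rewrite -invmx_unitary // mulVmx ?unitarymx_unit.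
have da i : d 0 i <= a.
  apply: aP; apply/eigenvalueP; exists (row i P).
    by rewrite -row_mul PX; apply/rowP => j; rewrite mul_diag_mx !mxE.
  apply/eqP => r0; have /rowP/(_ i) : row i (P *m P ^t*) = 0.
    by rewrite row_mul r0 mul0mx.
  by rewrite (unitarymxP Pu) !mxE eqxx; apply/eqP; rewrite oner_eq0.
have -> : x ^t* *m X *m x = (P *m x) ^t* *m diag_mx d *m (P *m x).
  by rewrite [in LHS]eX trmxC_mul !mulmxA.
have -> : x ^t* *m x = (P *m x) ^t* *m (P *m x).
  by rewrite trmxC_mul -mulmxA (mulmxA _ P) PP mul1mx.
rewrite -mulmxA mul_diag_mx !mxE mulr_sumr; apply: ler_sum => i _.
rewrite !mxE [leLHS]mulrCA; apply: ler_wpM2r; last exact: da.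
by rewrite mulrC -normCK exprn_ge0.
Qed.

Lemma mxtrace_rank1_mul n (u v w z : 'cV[C]_n) :
  \tr ((u *m v ^t*) *m (w *m z ^t*)) = \tr (v ^t* *m w) * \tr (z ^t* *m u).
Proof.
rewrite -mulmxA mxtrace_mulC -!mulmxA (mulmxA _ w).
by rewrite {1}[v ^t* *m w]mx11_scalar mul_scalar_mx mxtraceZ -trace_mx11.
Qed.

Lemma trmxC_rank1 n (u : 'cV[C]_n) : (u *m u ^t*) ^t* = u *m u ^t*.
Proof. by rewrite trmxC_mul trmxCK. Qed.

(** If y = X x were nonzero, a small step from x along -y would make the form negative. *)
Lemma psd_ker n (X : 'M[C]_n) (x : 'cV[C]_n) :
  X \is hermsymmx -> (forall y : 'cV[C]_n, 0 <= (y ^t* *m X *m y) 0 0) ->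
  (x ^t* *m X *m x) 0 0 = 0 -> X *m x = 0.
Proof.
move=> /hermsymmxE Xh Xpsd hx.
pose y := X *m x; pose n2 := \tr (y ^t* *m y); pose c := \tr (y ^t* *m X *m y).
have n0 : 0 <= n2 by rewrite /n2 mxtrace_mulC mxtrace_mulmxt_ge0.
have c0 : 0 <= c by rewrite /c trace_mx11.
have c1 : c + 1 != 0 by rewrite gt_eqF // ltr_wpDl.
(* The form at x - s y is s^2 c - 2 s |y|^2. This s gives s c = |y|^2 - s, and the added 1 covers c
   = 0. *)
pose s := n2 / (c + 1).
have s0 : 0 <= s by rewrite divr_ge0 // addr_ge0.
have ns : n2 = s * (c + 1) by rewrite /s divfK.
have xX : x ^t* *m X = y ^t* by rewrite /y trmxC_mul Xh.
have := Xpsd (x - s *: y); rewrite -trace_mx11.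
have -> : \tr ((x - s *: y) ^t* *m X *m (x - s *: y)) = - (s ^+ 2 + s * n2).
  rewrite trmxCB trmxCZ geC0_conj // !mulmxBl !mulmxBr xX.
  rewrite -?scalemxAr -?scalemxAl -?scalemxAr -(mulmxA _ X x) -/y.
  rewrite !(mxtraceD, mxtraceN, mxtraceZ) -/n2 -/c.
  have -> : \tr (y ^t* *m x) = 0 by rewrite -xX trace_mx11.
  by rewrite ns; ring.
rewrite oppr_ge0 => h.
have s2 : 0 <= s ^+ 2 by exact: exprn_ge0.
have sn : 0 <= s * n2 by exact: mulr_ge0.
have /eqP : s ^+ 2 + s * n2 = 0 by apply/eqP; rewrite eq_le h addr_ge0.
rewrite paddr_eq0 // expf_eq0 /= => /andP[/eqP s00 _].
apply: mxtrace_mulmxt_eq0; rewrite -/y.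
by rewrite mxtrace_mulC -/n2 ns s00 mul0r.
Qed.

(** With q = |f|^2 and t = f^* X f, the difference of the two sides is (a - q)^2 + 2 (a q - t), and
    t <= a q is the Rayleigh bound. *)
Lemma rank1_approx_le n (X : 'M[C]_n) (a : C) (v f : 'cV[C]_n) :
  X \is hermsymmx -> a \is Num.real ->
  (forall mu, eigenvalue X mu -> mu <= a) ->
  X *m v = a *: v -> \tr (v *m v ^t*) = 1 ->
  \tr ((X - a *: (v *m v ^t*)) *m (X - a *: (v *m v ^t*)) ^t*) <=
  \tr ((X - f *m f ^t*) *m (X - f *m f ^t*) ^t*).
Proof.
move=> Xh ar aP Xv v1; have /hermsymmxE Xt := Xh.
have fX := rayleigh_le f Xh aP.
rewrite -!trace_mx11 in fX.
have v1' : \tr (v ^t* *m v) = 1 by rewrite mxtrace_mulC.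
have vX : v ^t* *m X = a *: v ^t*.
  by rewrite -[in LHS]Xt -trmxC_mul Xv trmxCZ (CrealP ar).
have XF : \tr (X *m (f *m f ^t*)) = \tr (f ^t* *m X *m f).
  by rewrite mulmxA mxtrace_mulC mulmxA.
have FX : \tr (f *m f ^t* *m X) = \tr (f ^t* *m X *m f).
  by rewrite -mulmxA mxtrace_mulC.
rewrite !trmxCB trmxCZ !trmxC_rank1 Xt (CrealP ar) !mulmxBl !mulmxBr.
rewrite -?scalemxAr -?scalemxAl -?scalemxAr !(mxtraceD, mxtraceN, mxtraceZ).
rewrite !mxtrace_rank1_mul v1' XF FX (mulmxA X v) Xv -(mulmxA v _ X) vX.
rewrite -scalemxAr -scalemxAl !mxtraceZ v1.
set q := \tr (f ^t* *m f) in fX *.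
set t := \tr (f ^t* *m X *m f) in fX *.
have q0 : 0 <= q by rewrite /q mxtrace_mulC mxtrace_mulmxt_ge0.
rewrite -subr_ge0; set e := (E in 0 <= E).
suff -> : e = (a - q) ^+ 2 + 2 * (a * q - t).
  apply: addr_ge0; last by rewrite mulr_ge0 ?subr_ge0.
  by rewrite real_exprn_even_ge0 // rpredB // ger0_real.
by rewrite /e; ring.
Qed.

(* With p = |u|^2, q = |f|^2 and a = f^* u, the difference of the two sides is
   (p - q)^2 + (p + q - 2 a) (p + 2 a), where p + q - 2 a = |u - f|^2. *)
Lemma lift_dist_le n (u f : 'cV[C]_n) : 0 <= (f ^t* *m u) 0 0 ->
  \tr ((u - f) *m (u - f) ^t*) * \tr (f *m f ^t*) <=
  2 * \tr ((u *m u ^t* - f *m f ^t*) *m (u *m u ^t* - f *m f ^t*) ^t*).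
Proof.
rewrite -trace_mx11; set a := \tr _ => a0.
have a' : \tr (u ^t* *m f) = a.
  rewrite -(geC0_conj a0) /a !trace_mx11 !mxE rmorph_sum.
  apply: eq_bigr => i _; rewrite !mxE rmorphM /= conjCK; exact: mulrC.
have := mxtrace_mulmxt_ge0 (u - f); have := mxtrace_mulmxt_ge0 u.
have := mxtrace_mulmxt_ge0 f.
rewrite !trmxCB !trmxC_rank1 !mulmxBl !mulmxBr.
rewrite !(mxtraceD, mxtraceN) !mxtrace_rank1_mul a' -/a.
rewrite !(mxtrace_mulC u) !(mxtrace_mulC f) a' -/a.
set p := \tr (u ^t* *m u); set q := \tr (f ^t* *m f) => q0 p0 d0.
rewrite -subr_ge0; set e := (E in 0 <= E).
suff -> : e = (p - q) ^+ 2 + (p - a - (a - q)) * (p + a *+ 2).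
  apply: addr_ge0; last by rewrite mulr_ge0 // addr_ge0 // mulrn_wge0.
  by rewrite real_exprn_even_ge0 // rpredB // ger0_real.
by rewrite /e; ring.
Qed.

End Hermitian.

(** * Exact recovery from the band entries *)

Section Recovery.
Variable R : realType.
Local Notation C := R[i].

(** Kernel vectors supported on two indices at distance at most K make the corresponding columns of
    X proportional. Chaining these relations expresses every column through column 0, which
    Hermitian symmetry determines. *)
Lemma psd_rank1_unique (T K : nat) (f : 'cV[C]_T) (X : 'M[C]_T) :
  no_zero_run K f -> (forall i : 'I_T, i = 0%N :> nat -> f i 0 = 1) ->
  psdmx X ->
  (forall i j : 'I_T, (i <= j + K)%N -> (j <= i + K)%N ->
     X i j = lift_mx f i j) ->
  X = lift_mx f.
Proof.
move=> hf hf0 [Xh Xpsd] hband.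
case: T => [|T] in f X hf hf0 Xh Xpsd hband *.
  by apply/matrixP => -[].
have hb (i j : 'I_T.+1) : (i <= j + K)%N -> (j <= i + K)%N ->
    X i j = f i 0 * (f j 0)^*%R.
  by move=> h1 h2; rewrite hband // /lift_mx mxE big_ord1 !mxE.
have entry (i j : 'I_T.+1) :
    (delta_mx i 0 : 'cV[C]_T.+1) ^t* *m X *m (delta_mx j 0 : 'cV[C]_T.+1) =
    (X i j)%:M.
  rewrite trmx_delta map_delta_mx -rowE -colE.
  by apply/matrixP => k l; rewrite !ord1 !mxE.
(* The vector w = (f_j)^* e_i - (f_i)^* e_j is orthogonal to f and only meets
   band entries, so w^* X w = |f^* w|^2 = 0 and w is in the kernel of X. *)
have pair (i j : 'I_T.+1) k : (i <= j + K)%N -> (j <= i + K)%N ->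
    (f j 0)^*%R * X k i = (f i 0)^*%R * X k j.
  move=> ij ji.
  pose w : 'cV[C]_T.+1 :=
    (f j 0)^*%R *: delta_mx i 0 - (f i 0)^*%R *: delta_mx j 0.
  have /matrixP/(_ k 0) : X *m w = 0.
    apply: psd_ker => //.
    rewrite /w trmxCB !trmxCZ !conjCK !mulmxBl !mulmxBr.
    rewrite -!scalemxAl -!scalemxAr !entry !mxE !mulr1n.
    by rewrite !hb //; try lia; ring.
  rewrite /w mulmxBr -!scalemxAr -!colE !mxE => /eqP.
  by rewrite subr_eq0 => /eqP.
have pivot (j : 'I_T.+1) : (0 < j)%N ->
    exists i : 'I_T.+1, [/\ (i < j)%N, (j <= i + K)%N & f i 0 != 0].
  (* Near the start index 0 serves, since f is 1 there. Further on, the K entries just before j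
     cannot all vanish. *)
  move=> j0; have [jK|Kj] := leqP j K.
    by exists ord0; rewrite hf0 ?oner_neq0.
  apply: contrapT => /forallNP h; apply: hf; exists (j - K)%N.
  split=> [|i hi]; first by have := ltn_ord j; lia.
  apply/eqP; apply: contrapT => /negP fi; apply: (h i).
  by split => //; lia.
have col0 (j : 'I_T.+1) k : X k j = (f j 0)^*%R * X k ord0.
  elim/ltn_ind: {j}(j : nat) {-2}j (erefl (j : nat)) => m IH j jm.
  have [j0|] := posnP j.
    by rewrite hf0 // conjC1 mul1r; congr (X _ _); apply: val_inj.
  move=> /pivot[i [ij ji fi]].
  have fi' : (f i 0)^*%R != 0 by rewrite conjC_eq0.
  have ijK : (i <= j + K)%N by lia.
  by apply: (mulfI fi'); rewrite -(pair i j) // (IH i _ i) -?jm // mulrCA.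
have g k : X k ord0 = f k 0.
  (* Row 0 is already known from the column relations and X_00 = 1; conjugating it gives column
     0. *)
  have -> : X k ord0 = (X ord0 k)^*%R.
    by rewrite -[in LHS](hermsymmxE Xh) !mxE.
  by rewrite col0 rmorphM /= conjCK hb // (hf0 ord0) // !(conjC1, mulr1).
apply/matrixP => k j; rewrite col0 g /lift_mx mxE big_ord1 !mxE; exact: mulrC.
Qed.

Lemma meas_mapB T K (X Y : 'M[C]_T) :
  meas_map K (X - Y) = meas_map K X - meas_map K Y.
Proof.
by apply/matrixP => i j; rewrite !mxE mulmxBr mxtraceD mxtraceN.
Qed.

(** Up to nonzero factors, the two measurements of a pair are X j i + X i j and X j i - X i j, so
    both entries vanish even for a non-Hermitian X. *)
Lemma meas_map_eq0 (T K : nat) (X : 'M[C]_T) : (0 < K < T)%N ->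
  meas_map K X = 0 ->
  forall i j : 'I_T, (i <= j + K)%N -> (j <= i + K)%N -> X i j = 0.
Proof.
move=> hK h0.
have hM M : M \in meas_mxs R T K -> \tr (M *m X) = 0.
  move=> /(nthP 0)[k]; rewrite size_meas_mxs // => hk <-.
  by have /matrixP/(_ (Ordinal hk) 0) := h0; rewrite !mxE.
have trd (i j : 'I_T) : \tr (delta_mx i j *m X) = X j i.
  rewrite -(mul_delta_mx (0 : 'I_1)) -mulmxA mxtrace_mulC -rowE -colE.
  by rewrite trace_mx11 !mxE.
have hlt (i j : 'I_T) : (i < j)%N -> (j - i <= K)%N -> X i j = 0 /\ X j i = 0.
  move=> ij jiK.
  have ijb : (i, j) \in band_pairs T K by rewrite mem_filter /= ij jiK mem_enum.
  have := hM (meas_re R i j); rewrite !mem_cat.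
  rewrite (map_f (fun p => meas_re R p.1 p.2) ijb) orbT => /(_ isT).
  have := hM (meas_im R i j); rewrite !mem_cat.
  rewrite (map_f (fun p => meas_im R p.1 p.2) ijb) !orbT => /(_ isT).
  rewrite -!scalemxAl mulmxBl mulmxDl !mxtraceZ !mxtraceD mxtraceN !trd.
  move=> /eqP; rewrite mulf_eq0 invr_eq0 mulf_eq0 pnatr_eq0 /=.
  rewrite eq_complex /= oner_eq0 andbF /= subr_eq0 => /eqP e.
  move=> /eqP; rewrite mulf_eq0 invr_eq0 pnatr_eq0 /= e -mulr2n mulrn_eq0 /=.
  by move=> /eqP.
move=> i j h1 h2; case: (ltngtP i j) => ij.
- by have [] := hlt i j ij; first by lia.
- by have [] := hlt j i ij; first by lia.
- move/val_inj: ij => <-.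
  by rewrite -trd hM // !mem_cat (map_f (fun k => delta_mx k k)) ?mem_enum.
Qed.

(** * The real Frobenius norm and its expression as a complex trace *)

Lemma norm2_ge0 m n (M : 'M[C]_(m, n)) : 0 <= norm2 M.
Proof. exact: sqrtr_ge0. Qed.

Lemma norm2_sqr m n (M : 'M[C]_(m, n)) :
  (norm2 M ^+ 2)%:C = \tr (M *m M ^t*).
Proof.
rewrite mxtrace_mulmxtE sqr_sqrtr; last first.
  by apply: sumr_ge0 => i _; apply: sumr_ge0 => j _; exact: sqr_ge0.
rewrite rmorph_sum; apply: eq_bigr => i _; rewrite rmorph_sum.
apply: eq_bigr => j _; rewrite rmorphXn /= normc_def.
by case: (M i j).
Qed.

(** * Angles and the choice of the global phase *)

Lemma unit_circle_param (x y : R) : x ^+ 2 + y ^+ 2 = 1 ->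
  exists phi : R, [/\ 0 <= phi, phi < 2 * pi, cos phi = x & sin phi = y].
Proof.
move=> xy.
have x1 : -1 <= x <= 1 by nra.
have ax : cos (acos x) = x by rewrite acosK // in_itv.
have sx : sin (acos x) = `|y|.
  by rewrite sin_acos // -xy addrAC subrr add0r sqrtr_sqr.
have p0 := pi_gt0 R; have a0 := acos_ge0 x1; have api := acos_lepi x1.
have [y0|y0] := leP 0 y.
  exists (acos x); split=> //; first by lra.
  by rewrite sx ger0_norm.
exists (2 * pi - acos x); split.
- by lra.
(* The angle stays strictly below 2 pi because y < 0 forces x < 1. *)
- suff : 0 < acos x by lra.
  by apply: acos_gt0; nra.
- by rewrite mulr_natl addrC cosD2pi cosN.
- by rewrite mulr_natl addrC sinD2pi sinN sx ltr0_norm // opprK.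
Qed.

Lemma norm_expi phi : `|expi phi : C| = 1.
Proof. by rewrite normc_def /= cos2Dsin2 sqrtr1. Qed.

(** An argument of z works, the product then being |z|. *)
Lemma phase_alignment (z : C) : exists phi : R,
  [/\ 0 <= phi, phi < 2 * pi & 0 <= (expi phi)^*%R * z].
Proof.
have [->|z0] := eqVneq z 0.
  by exists 0; rewrite mulr0; have := pi_gt0 R; split=> //; lra.
have n1 : `|z / `|z| | = 1 by rewrite normf_div normr_id divff ?normr_eq0.
case e : (z / `|z|) => [x y].
have [|phi [h0 h2 hc hs]] := @unit_circle_param x y.
  by apply: complexI; rewrite (add_Re2_Im2 (x +i* y)) -e n1 expr1n.
exists phi; split=> //.
have -> : z = expi phi * `|z| by rewrite /expi hc hs -e divfK ?normr_eq0.
by rewrite mulrA [_ * expi _]mulrC -normCK norm_expi expr1n mul1r.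
Qed.

(** * Norm bounds for lifts and for the estimate *)

Lemma norm2_eq0 m n (M : 'M[C]_(m, n)) : norm2 M = 0 -> M = 0.
Proof.
by move=> M0; apply: mxtrace_mulmxt_eq0; rewrite -norm2_sqr M0 expr0n.
Qed.

Lemma norm2N m n (M : 'M[C]_(m, n)) : norm2 (- M) = norm2 M.
Proof.
congr Num.sqrt; apply: eq_bigr => i _; apply: eq_bigr => j _.
by rewrite mxE normcN.
Qed.

Lemma norm2B_sqr_le m n (A B : 'M[C]_(m, n)) :
  norm2 (A - B) ^+ 2 <= 2 * (norm2 A ^+ 2 + norm2 B ^+ 2).
Proof.
rewrite -lecR [leRHS]rmorphM rmorph_nat rmorphD /= !norm2_sqr.
exact: parallelogram_le.
Qed.

Lemma psdmx_lift T (f : 'cV[C]_T) : psdmx (lift_mx f).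
Proof.
split=> [|x].
  by apply/is_hermitianmxP; rewrite expr0 scale1r trmxC_rank1.
have -> : x ^t* *m lift_mx f *m x = (x ^t* *m f) *m (x ^t* *m f) ^t*.
  by rewrite trmxC_mul trmxCK !mulmxA.
by rewrite -trace_mx11 mxtrace_mulmxt_ge0.
Qed.

Lemma lift_mx_phase T (c : C) (f : 'cV[C]_T) : `|c| = 1 ->
  lift_mx (c *: f) = lift_mx f.
Proof.
move=> c1; rewrite /lift_mx trmxCZ -scalemxAl -scalemxAr scalerA -normCK c1.
by rewrite expr1n scale1r.
Qed.

(** Writing U for the lift of the estimate, U - f f^* is the difference of X - f f^* and X - U. The
    second is no longer than the first, so the parallelogram bound gives 2 (1 + 1) = 4. *)
Lemma estimate_lift_le T (X : 'M[C]_T) (lam : R) (v f : 'cV[C]_T) (c : C) :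
  psdmx X -> largest_eigenvalue X lam -> X *m v = lam%:C *: v ->
  norm2 v = 1 -> `|c| = 1 ->
  norm2 (lift_mx (c *: ((Num.sqrt lam)%:C *: v)) - lift_mx f) ^+ 2 <=
  4 * norm2 (X - lift_mx f) ^+ 2.
Proof.
move=> [Xh Xpsd] [_ lmax] Xv v1 c1; set u := (Num.sqrt lam)%:C *: v.
have v1' : \tr (v *m v ^t*) = 1 by rewrite -norm2_sqr v1 expr1n.
(* [Num.sqrt] is 0 on negative reals, so its square is [lam] only once v^* X v = [lam] has shown
   [lam] to be nonnegative. *)
have lam0 : 0 <= lam.
  rewrite -ler0c; have := Xpsd v.
  by rewrite -mulmxA Xv -scalemxAr mxE -trace_mx11 mxtrace_mulC v1' mulr1.
have : lift_mx (c *: u) = lam%:C *: (v *m v ^t*).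
  rewrite lift_mx_phase // /lift_mx /u trmxCZ -scalemxAl -scalemxAr scalerA.
  by rewrite geC0_conj ?ler0c ?sqrtr_ge0 // -rmorphM -expr2 sqr_sqrtr.
move: (lift_mx (c *: u)) => U eU.
have ge_U : norm2 (X - U) ^+ 2 <= norm2 (X - lift_mx f) ^+ 2.
  have lamr : lam%:C \is Num.real by rewrite ger0_real // ler0c.
  have := rank1_approx_le f Xh lamr lmax Xv v1'.
  by rewrite -eU -[f *m _]/(lift_mx f) -!norm2_sqr lecR.
have -> : U - lift_mx f = (X - lift_mx f) - (X - U).
  by move: (lift_mx f) => F; rewrite opprB [RHS]addrC addrA subrK.
have := norm2B_sqr_le (X - lift_mx f) (X - U); lra.
Qed.

(** Rotating f changes neither its lift nor its norm, so [lift_dist_le] applies to the rotated f. *)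
Lemma dist_lift_le T (u f : 'cV[C]_T) : exists phi : R,
  [/\ 0 <= phi, phi < 2 * pi &
    norm2 (u - expi phi *: f) ^+ 2 * norm2 f ^+ 2 <=
    2 * norm2 (lift_mx u - lift_mx f) ^+ 2].
Proof.
have [phi [h0 h2 hz]] := phase_alignment ((f ^t* *m u) 0 0).
exists phi; split=> //.
have ph : lift_mx (expi phi *: f) = lift_mx f.
  by apply: lift_mx_phase; exact: norm_expi.
rewrite -lecR [leLHS]rmorphM [leRHS]rmorphM rmorph_nat /= !norm2_sqr.
rewrite -[f *m f ^t*]ph -ph.
by apply: lift_dist_le; rewrite trmxCZ -scalemxAl mxE.
Qed.

(** The disjunction isolates the degenerate values of s. If s = 0, the right side is +oo as soon as
    k and e are positive; s = +oo is excluded by r and remains possible only with d = 0. *)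
Lemma le_dive_mule (k d e F : R) (s : \bar R) :
  0 <= k -> 0 <= d -> 0 <= e -> 0 < F -> (0 <= s)%E ->
  d = 0 \/ (0 < k * e /\ exists2 r : R, (s <= r%:E)%E & d * F * r <= k * e) ->
  (d%:E <= k%:E / s * (e / F)%:E)%E.
Proof.
move=> k0 d0 e0 F0 s0 [->|[ke [r]]].
  by rewrite !mule_ge0 ?inve_ge0 ?lee_fin // divr_ge0 // ltW.
have kp : 0 < k by nra.
have ep : 0 < e by nra.
case: s s0 => [t| |] //; rewrite !lee_fin => t0 tr h.
rewrite inver; case: eqP => [_|/eqP tn0].
  by rewrite gt0_muley ?lte_fin // gt0_mulye ?leey // lte_fin divr_gt0.
have tp : 0 < t by rewrite lt_neqAle eq_sym tn0.
rewrite -!EFinM lee_fin mulf_div ler_pdivlMr ?mulr_gt0 //.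
by apply: le_trans h; rewrite (mulrC t) mulrA ler_wpM2l // mulr_ge0 // ltW.
Qed.

End Recovery.

Unset Implicit Arguments.
Set Strict Implicit.

Theorem theorem15 (R : realType) (T K : nat) (hK : (1 <= K <= T - 1)%N)
  (f : 'cV[R[i]]_T) (hf : no_zero_run K f)
  (hf0 : forall i : 'I_T, i = 0%N :> nat -> f i 0 = 1)
  (eps : 'cV[R]_(meas_dim T K)) (fhat : 'cV[R[i]]_T) :
  let Z := lift_mx f in
  let epsC := map_mx (real_complex R) eps in
  let b := meas_map K Z + epsC in
  ls_estimate b fhat ->
  exists phi : R, [/\ 0 <= phi, phi < 2 * pi &
    ((norm2 (fhat - expi phi *: f))%:E <=
      (2 * (2 * Num.sqrt 2 + 1))%:E
        / conic_sv (meas_map K) (descent_cone (loss b) Z)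
        * (norm2 epsC / norm2 f)%:E)%E].
Proof.
move=> Z epsC b [X [lam [v [c [[Xpsd Xmin] Xmax [Xv v1] c1 ->]]]]].
have [phi [phi0 phi2 hd]] := dist_lift_le (c *: ((Num.sqrt lam)%:C *: v)) f.
have := estimate_lift_le f Xpsd Xmax Xv v1 c1.
rewrite -/Z in hd *; set D := X - Z => hD; exists phi; split=> //.
set d := norm2 _ in hd *.
have KT : (0 < K < T)%N by lia.
have lossZ : loss b Z = norm2 epsC ^+ 2 by rewrite /loss /b opprD addNKr norm2N.
have lossX : loss b X = norm2 (meas_map K D - epsC) ^+ 2.
  by rewrite /loss /b /D meas_mapB opprD addrA.
have leX : loss b X <= loss b Z by apply: Xmin; exact: psdmx_lift.
have AD : norm2 (meas_map K D) <= 2 * norm2 epsC.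
  (* A(D) is the residual at X minus the residual at Z, and neither is longer than [epsC]. *)
  have := norm2B_sqr_le (meas_map K D - epsC) (- epsC).
  rewrite opprK subrK norm2N -lossX.
  have := norm2_ge0 epsC; have := norm2_ge0 (meas_map K D).
  by rewrite lossZ in leX; nra.
have F0 : 0 < norm2 f.
  rewrite lt_neqAle norm2_ge0 andbT eq_sym; apply/eqP => /norm2_eq0 f0.
  have T0 : (0 < T)%N by lia.
  have := hf0 (Ordinal T0) erefl; rewrite f0 mxE => /eqP.
  by rewrite eq_sym oner_eq0.
have s2 : Num.sqrt 2 ^+ 2 = 2 :> R by rewrite sqr_sqrtr.
have s0 : 0 <= Num.sqrt 2 :> R by exact: sqrtr_ge0.
(* The squared constant is 2 * 4: 2 from passing from lifts to vectors, 4 from the rank-one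
   approximation. *)
have dF : d * norm2 f <= 2 * Num.sqrt 2 * norm2 D.
  rewrite -(@ler_pXn2r _ 2) ?nnegrE ?mulr_ge0 ?norm2_ge0 //.
  by rewrite !exprMn s2; lra.
have k0 : 0 < 2 * (2 * Num.sqrt 2 + 1) :> R by lra.
have sig0 : (0 <= conic_sv (meas_map K) (descent_cone (loss b) Z))%E.
  apply: le_ereal_inf_tmp => _ [M _ <-].
  by rewrite lee_fin divr_ge0 ?norm2_ge0.
apply: (le_dive_mule (ltW k0) (norm2_ge0 _) (norm2_ge0 _) F0 sig0).
have [D0|/eqP D0] := eqVneq D 0.
  left; apply/eqP; rewrite eq_le norm2_ge0 andbT.
  move: dF; rewrite D0.
  have -> : norm2 (0 : 'M[R[i]]_T) = 0.
    apply/eqP; rewrite -sqrf_eq0 -(inj_eq (@complexI R)) norm2_sqr.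
    by rewrite mul0mx mxtrace0.
  by rewrite mulr0 pmulr_lle0.
have Dp : 0 < norm2 D.
  rewrite lt_neqAle norm2_ge0 andbT eq_sym; apply/eqP => /norm2_eq0; exact: D0.
right; split.
  rewrite mulr_gt0 //.
  (* Without noise A(D) = 0, so X and Z agree on the band and are equal by uniqueness, against D <>
     0. *)
  rewrite lt_neqAle norm2_ge0 andbT eq_sym; apply/eqP => e0; apply: D0.
  have /(meas_map_eq0 KT) hband : meas_map K D = 0.
    apply: norm2_eq0; apply/eqP; rewrite eq_le norm2_ge0 andbT.
    by rewrite e0 mulr0 in AD.
  apply/eqP; rewrite subr_eq0; apply/eqP.
  apply: (psd_rank1_unique hf hf0 Xpsd) => i j h1 h2; apply/eqP.
  by rewrite -subr_eq0 -(hband i j) // /D !mxE.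
(* D itself lies in the cone, with step 1, so its quotient bounds the infimum from above. *)
exists (norm2 (meas_map K D) / norm2 D).
  apply: ereal_inf_lbound; exists D => //; split=> //; exists 1 => //.
  by rewrite scale1r addrC subrK.
rewrite mulrA ler_pdivrMr //.
apply: (@le_trans _ _ ((2 * Num.sqrt 2 * norm2 D) * (2 * norm2 epsC))).
  by apply: ler_pM; rewrite ?mulr_ge0 ?norm2_ge0 // ltW.
(* The product has constant 4 sqrt 2, which is below 2 (2 sqrt 2 + 1). *)
have := norm2_ge0 epsC; nra.
Qed.
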